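(* Let $A\in\mathbb{R}^{n\times n}$ be stable, let $V=\{b_1,\dots,b_M\}$ be a finite set of column vectors in $\mathbb{R}^n$, not all zero, and let $B_0\in\mathbb{R}^{n\times m}$ be such that $W_{B_0}=\int_0^\infty e^{A\tau}B_0B_0^Te^{A^T\tau}\,d\tau$ is positive definite. For $S\subseteq V$ let $\bar W_S=W_{B_0}+\int_0^\infty e^{A\tau}\big(\sum_{b\in S} b b^T\big)e^{A^T\tau}\,d\tau$. Consider the set function $f:2^V\to\mathbb{R}$, $f(S)=-\operatorname{tr}\big(\bar W_S^{-1}\big)$, with submodularity ratio $\gamma$ and curvature $\alpha$. Let $1\leq k\leq M$, let $f^*=\max\{f(S): S\subseteq V,\ |S|\leq k\}$, and let $S_{greedy}$ be any set produced by the greedy algorithm with cardinality bound $k$. Then $$f(S_{greedy})-f(\emptyset)\ \geq\ \frac{1}{\alpha}\left(1-e^{-\alpha\gamma}\right)\big(f^*-f(\emptyset)\big).$$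
   Context: A real square matrix $A$ is stable if all its eigenvalues have strictly negative real part. The set $V$ is the set of possible additional actuator locations, and $B_0$ is the input matrix of an existing base set of actuators rendering the system controllable; $\bar W_S$ is the infinite-horizon controllability Gramian for the input matrix $[B_0,\ b_{s_1},\dots,b_{s_{|S|}}]$, and $\bar W_\emptyset=W_{B_0}$. Elements of $V$ are indexed by $1,\dots,M$. A single element $\omega\in V$ is identified with the singleton $\{\omega\}$. Let $f:2^V\to\mathbb{R}$ be a set function. For $A,B\subseteq V$ write $\rho_A(B):=f(A\cup B)-f(B)$ for the marginal benefit of $A$ with respect to $B$. The submodularity ratio of $f$ is the largest $\gamma\in\mathbb{R}_+$ (nonnegative reals) such that $\sum_{\omega\in\Omega\setminus S}\rho_\omega(S)\geq\gamma\,\rho_\Omega(S)$ for all $\Omega,S\subseteq V$. The curvature of $f$ is the smallest $\alpha\in\mathbb{R}_+$ such that $\rho_j\big((S\setminus\{j\})\cup\Omega\big)\geq(1-\alpha)\,\rho_j(S\setminus\{j\})$ for all $\Omega,S\subseteq V$ and all $j\in S\setminus\Omega$. Greedy algorithm with cardinality bound $k$: start with $S=\emptyset$; while $|S|<k$, choose $e^\star\in\arg\max_{e\in V\setminus S}\big(f(S\cup\{e\})-f(S)\big)$ (ties broken arbitrarily) and replace $S$ by $S\cup\{e^\star\}$; the output $S_{greedy}$ is the final set $S$, which has exactly $k$ elements. If $\alpha=0$, the factor $\frac1\alpha(1-e^{-\alpha\gamma})$ is read as its limit $\gamma$ as $\alpha\to0^+$. *)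

(* Defs.v *)
From HB Require Import structures.
From mathcomp Require Import all_boot all_order all_algebra.
From mathcomp Require Import all_classical all_reals all_analysis.
From mathcomp Require Import complex.
Import Order.TTheory GRing.Theory Num.Theory.
Import numFieldNormedType.Exports.

Set Implicit Arguments.
Unset Strict Implicit.
Unset Printing Implicit Defensive.

Local Open Scope classical_set_scope.
Local Open Scope ring_scope.

Section SetFunctions.
Context {R : realType} {T : finType}.
Implicit Types (f : {set T} -> R) (S Om : {set T}).

Definition marginal f (A B : {set T}) : R := f (A :|: B) - f B.

Definition submod_ratio_bound f (g : R) : Prop :=
  forall Om S : {set T},
    \sum_(w in Om :\: S) marginal f [set w]%SET S >= g * marginal f Om S.

Definition is_submodularity_ratio f (g : R) : Prop :=
  [/\ 0 <= g, submod_ratio_bound f g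
    & forall g', 0 <= g' -> submod_ratio_bound f g' -> g' <= g].

Definition curvature_bound f (a : R) : Prop :=
  forall (Om S : {set T}) (j : T), j \in S :\: Om ->
    marginal f [set j]%SET ((S :\ j) :|: Om)
      >= (1 - a) * marginal f [set j]%SET (S :\ j).

Definition is_curvature f (a : R) : Prop :=
  [/\ 0 <= a, curvature_bound f a
    & forall a', 0 <= a' -> curvature_bound f a' -> a <= a'].

Definition greedy_choice f S (e : T) : Prop :=
  e \notin S /\
  forall e', e' \notin S -> f (e' |: S) - f S <= f (e |: S) - f S.

(* The sets reachable by the loop "while #|S| < k, add a greedy choice";
   a relation rather than a function, so that ties are broken arbitrarily. *)
Inductive greedy_state f (k : nat) : {set T} -> Prop :=
| greedy_start : greedy_state f k (finset.set0)
| greedy_step S e : greedy_state f k S -> (#|S| < k)%N ->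
    greedy_choice f S e -> greedy_state f k (e |: S).

Definition greedy_output f (k : nat) S : Prop :=
  greedy_state f k S /\ ~~ (#|S| < k)%N.

(* The empty set satisfies the cardinality constraint, so seeding the iterated
   maximum with its value does not change the maximum. *)
Definition card_max f (k : nat) : R :=
  \big[Num.max/f (finset.set0)]_(S : {set T} | (#|S| <= k)%N) f S.

End SetFunctions.

(* (1 - exp (- a g)) / a, extended by its limit g at a = 0. *)
Definition greedy_factor {R : realType} (a g : R) : R :=
  if a == 0 then g else a^-1 * (1 - expR (- (a * g))).

Section Gramian.
Context {R : realType}.

(* The eigenvalues are the complex ones: A is first mapped into R[i]. *)
Definition stable n (A : 'M[R]_n) : Prop :=
  forall z : R[i], eigenvalue (map_mx (real_complex R) A) z -> complex.Re z < 0.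

Definition posdefmx n (W : 'M[R]_n) : Prop :=
  W^T = W /\ forall x : 'cV[R]_n, x != 0 -> 0 < (x^T *m W *m x) ord0 ord0.

Definition expmx n (A : 'M[R]_n) : 'M[R]_n :=
  limn (series (fun k => k`!%:R^-1 *: A ^+ k)).

(* The matrix integral over [0, +oo[ is taken entrywise; the Gramian of an
   input matrix B is the case Q = B *m B^T. *)
Definition gramian n (A Q : 'M[R]_n) : 'M[R]_n :=
  \matrix_(i, j) \int[lebesgue_measure]_(t in `[0, +oo[)
    (expmx (t *: A) *m Q *m expmx (t *: A^T)) i j.

Definition gramian_with n m M (A : 'M[R]_n) (B0 : 'M[R]_(n, m))
    (b : 'I_M -> 'cV[R]_n) (S : {set 'I_M}) : 'M[R]_n :=
  gramian A (B0 *m B0^T) + gramian A (\sum_(j in S) b j *m (b j)^T).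

Definition neg_tr_inv_gramian n m M (A : 'M[R]_n) (B0 : 'M[R]_(n, m))
    (b : 'I_M -> 'cV[R]_n) (S : {set 'I_M}) : R :=
  - \tr (invmx (gramian_with A B0 b S)).

End Gramian.

(* Main.v *)
Require Import Defs.
From mathcomp Require Import all_boot all_order all_algebra.
From mathcomp Require Import all_classical all_reals all_analysis.
From mathcomp Require Import measurable_realfun.
From mathcomp Require Import ring lra.
Import Order.TTheory GRing.Theory Num.Theory.
Import numFieldNormedType.Exports.
Local Open Scope ring_scope.

(* For a nondecreasing [f], let [Om] be optimal and [r] the part of its gain
   not yet accounted for: [f Om - f set0] minus the gains of the greedy steps
   inside [Om] and minus [alpha] times the gains of those outside.  With [m]
   elements of [Om] left, curvature and submodularity ratio give
   [gamma * r <= m * rho] for the next greedy gain [rho].  As long as [s <= m]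
   steps remain, [r * (1 - exp (- alpha * gamma * s / m)) / alpha] is therefore
   a lower bound on the gain still to come.

   That [f S = - tr (W_S^-1)] is nondecreasing requires the Gramian integrals to
   converge.  Positive definiteness of [W_B0] makes the entries of [e^(tA) B0]
   square integrable; by translation so are those of [e^(tA) e^(sA) B0], and by
   controllability the columns of the [e^(sA) B0] span the whole space. *)

(** * The greedy bound *)

Section GreedyFactor.
Context {R : realType}.
Implicit Types a g t h : R.

Lemma greedy_factor0 a : greedy_factor a 0 = 0.
Proof. by rewrite /greedy_factor mulr0 oppr0 expR0 subrr mulr0; case: ifP. Qed.

Lemma mul_greedy_factor a g :
  a != 0 -> a * greedy_factor a g = 1 - expR (- (a * g)).
Proof.
by move=> a0; rewrite /greedy_factor (negPf a0) mulrA divff // mul1r.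
Qed.

(** This quantity is [expR (- (a * g))], the derivative of the factor in [g]. *)
Lemma greedy_factor_slope_ge0 a g : 0 <= 1 - a * greedy_factor a g.
Proof.
have [->|a0] := eqVneq a 0; first by rewrite mul0r subr0.
by rewrite mul_greedy_factor // opprB addrC subrK expR_ge0.
Qed.

(** Concavity in [g]: the graph lies below its tangents, by [1 + x <= expR x]. *)
Lemma greedy_factor_tangent a g h : 0 <= a ->
  greedy_factor a (g + h) <=
  greedy_factor a g + h * (1 - a * greedy_factor a g).
Proof.
move=> a_ge0; have [->|a0] := eqVneq a 0.
  by rewrite /greedy_factor eqxx mul0r subr0 mulr1.
have a_gt0 : 0 < a by rewrite lt_neqAle eq_sym a0.
rewrite -(ler_pM2l a_gt0) mulrDr !mul_greedy_factor //.
have := expR_ge1Dx (- (a * h)); have := expR_gt0 (- (a * g)).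
rewrite mulrDr opprD expRD => u_gt0 eh; nra.
Qed.

Lemma greedy_factor_mono a g h : 0 <= a -> g <= h ->
  greedy_factor a g <= greedy_factor a h.
Proof.
move=> a_ge0 gh; have [->|a0] := eqVneq a 0.
  by rewrite /greedy_factor eqxx.
have a_gt0 : 0 < a by rewrite lt_neqAle eq_sym a0.
rewrite -(ler_pM2l a_gt0) !mul_greedy_factor // lerD2l lerN2 ler_expR lerN2.
by rewrite ler_pM2l.
Qed.

(** Serves the steps inside [Om], where the fraction of remaining steps drops from [s.+1 / m.+1] to
    [t = s / m], a change of [(1 - t) / m.+1]. *)
Lemma greedy_factor_secant a g t : 0 <= a <= 1 -> 0 <= g <= 1 -> 0 <= t <= 1 ->
  (1 - a * greedy_factor a (g * t)) * (1 - t) <= 1 - greedy_factor a (g * t).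
Proof.
move=> /andP[a_ge0 a1] /andP[g0 g1] /andP[t0 t1].
have gt_le : g * t <= t by nra.
have [->|a0] := eqVneq a 0.
  by rewrite /greedy_factor eqxx mul0r subr0 mul1r lerD2l lerN2.
have a_gt0 : 0 < a by rewrite lt_neqAle eq_sym a0.
rewrite -(ler_pM2l a_gt0) mulrA [a * (1 - greedy_factor _ _)]mulrBr.
rewrite !mul_greedy_factor //.
set u := expR (- (a * (g * t))).
have u0 : 0 < u by exact: expR_gt0.
have u_ge : 1 - a * t <= u.
  by apply: le_trans (expR_ge1Dx _); rewrite lerD2l lerN2 ler_wpM2l.
(* The claim is now [1 - a <= u * (1 - a + a * t)]. With [1 - a * t] in place of [u], the two sides
   differ by [a ^+ 2 * t * (1 - t)]. *)
have at0 : 0 <= 1 - a + a * t by nra.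
have := ler_wpM2r at0 u_ge.
have : 0 <= a * a * (t * (1 - t)) by rewrite !mulr_ge0 ?subr_ge0.
lra.
Qed.

End GreedyFactor.

(** * The potential argument along a greedy run *)

Section Greedy.
Context {R : realType} {T : finType}.
Variables (f : {set T} -> R) (a g : R).
Hypothesis f_mono : forall (S : {set T}) e, f S <= f (e |: S).
Hypotheses (a_ge0 : 0 <= a) (a_le1 : a <= 1) (a_curv : curvature_bound f a).
Hypotheses (g_ge0 : 0 <= g) (g_le1 : g <= 1) (g_ratio : submod_ratio_bound f g).

Lemma curvature_step (Om S : {set T}) e : e \notin S -> e \notin Om ->
  (1 - a) * (f (e |: S) - f S) <= f (Om :|: (e |: S)) - f (Om :|: S).
Proof.
move=> eS eOm; have eSK : (e |: S) :\ e = S by rewrite finset.setU1K.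
have := a_curv Om (e |: S) e; rewrite !inE eqxx eOm /= => /(_ isT).
by rewrite /marginal eSK [Om :|: (e |: S)]finset.setUCA [Om :|: S]finset.setUC.
Qed.

Lemma ratio_step (Om S : {set T}) e : greedy_choice f S e ->
  g * (f (Om :|: S) - f S) <= #|Om :\: S|%:R * (f (e |: S) - f S).
Proof.
move=> [_ e_max]; apply: le_trans (g_ratio Om S) _.
rewrite mulr_natl -sumr_const; apply: ler_sum => w.
by rewrite inE => /andP[wS _]; exact: e_max.
Qed.

(* [r] is the unaccounted gain, [m] the number of elements of [Om] not yet
   chosen and [rho] the gain of a step that leaves [s] further steps; the step
   chooses an element outside [Om] here, inside [Om] in the next lemma. *)
Lemma greedy_potential_out (m s : nat) (r rho : R) : (s < m)%N -> 0 <= rho ->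
  g * r <= m%:R * rho ->
  r * greedy_factor a (g * (s.+1%:R / m%:R)) <=
  rho + (r - a * rho) * greedy_factor a (g * (s%:R / m%:R)).
Proof.
move=> sm rho0 hr.
have m0 : 0 < m%:R :> R by rewrite ltr0n (leq_ltn_trans _ sm).
have hrho : g / m%:R * r <= rho by rewrite mulrAC ler_pdivrMr // [rho * _]mulrC.
rewrite -natr1 mulrDl mul1r mulrDr.
set p := greedy_factor a (g * (s%:R / m%:R)).
set q := greedy_factor a _.
have gm0 : 0 <= g / m%:R by rewrite divr_ge0 // ltW.
have slope : 0 <= 1 - a * p by exact: greedy_factor_slope_ge0.
have pq : p <= q by rewrite greedy_factor_mono // lerDl.
have qp : q <= p + g / m%:R * (1 - a * p) by exact: greedy_factor_tangent.
(* The tangent bound gets multiplied by [r], so its sign matters; for [r <= 0], [p <= q] already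
   gives [r * q <= r * p]. *)
have [r0|r0] := leP r 0.
  have := ler_wnM2l r0 pq; have := mulr_ge0 rho0 slope; lra.
have := ler_wpM2l (ltW r0) qp; have := ler_wpM2r slope hrho; lra.
Qed.

Lemma greedy_potential_in (m s : nat) (r rho : R) : (s <= m)%N -> 0 <= rho ->
  g * r <= m.+1%:R * rho ->
  r * greedy_factor a (g * (s.+1%:R / m.+1%:R)) <=
  rho + (r - rho) * greedy_factor a (g * (s%:R / m%:R)).
Proof.
move=> sm rho0 hr.
have m10 : 0 < m.+1%:R :> R by rewrite ltr0n.
have hrho : g / m.+1%:R * r <= rho.
  by rewrite mulrAC ler_pdivrMr // [rho * _]mulrC.
set t : R := s%:R / m%:R.
(* For [m = 0] also [s = 0], and [t] is 0 by the convention for division by zero; the identity [tE]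
   below stays true in this case. *)
have t01 : 0 <= t <= 1.
  rewrite /t; case: m sm {hr m10 hrho t} => [|m] sm.
    by rewrite invr0 mulr0 lexx ler01.
  by rewrite divr_ge0 //= ler_pdivrMr ?ltr0n // mul1r ler_nat.
have [t0 t1] := andP t01.
have tE : s.+1%:R / m.+1%:R = t + (1 - t) / m.+1%:R.
  have sE : s%:R = t * m%:R.
    rewrite /t; case: m sm {hr m10 hrho t t01 t0 t1} => [|m] sm.
      by move: sm; rewrite leqn0 => /eqP ->; rewrite mulr0.
    by rewrite divfK // pnatr_eq0.
  rewrite -[s.+1%:R]natr1 sE -[m.+1%:R]natr1; field.
  by rewrite natr1 pnatr_eq0.
rewrite tE mulrDr.
set p := greedy_factor a (g * t); set h := g * ((1 - t) / m.+1%:R).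
set q := greedy_factor a _.
have h0 : 0 <= h by rewrite mulr_ge0 ?divr_ge0 ?subr_ge0 // ltW.
have slope : 0 <= 1 - a * p by exact: greedy_factor_slope_ge0.
have pq : p <= q by rewrite greedy_factor_mono // lerDl.
have qp : q <= p + h * (1 - a * p) by exact: greedy_factor_tangent.
have sec : (1 - a * p) * (1 - t) <= 1 - p.
  by apply: greedy_factor_secant => //; rewrite ?a_ge0 ?g_ge0.
have gm0 : 0 <= g / m.+1%:R by rewrite divr_ge0 // ltW.
have p1 : 0 <= 1 - p by apply: le_trans sec; rewrite mulr_ge0 // subr_ge0.
have [r0|r0] := leP r 0.
  have := ler_wnM2l r0 pq; have := mulr_ge0 rho0 p1; lra.
have hE : h * (1 - a * p) <= g / m.+1%:R * (1 - p).
  have -> : h * (1 - a * p) = g / m.+1%:R * ((1 - a * p) * (1 - t)).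
    by rewrite /h; ring.
  exact: ler_wpM2l.
have := ler_wpM2l (ltW r0) (le_trans qp (lerD (lexx _) hE)).
have := ler_wpM2r p1 hrho.
move: (g / m.+1%:R) => gm; lra.
Qed.

Lemma greedy_state_mono k S : greedy_state f k S -> f finset.set0 <= f S.
Proof. by elim=> // S' e _ IH _ _; apply: le_trans IH (f_mono _ _). Qed.

(* [c] is the total gain of the steps that chose an element outside [Om]. *)
Lemma greedy_invariant k (Om S : {set T}) : greedy_state f k S ->
  (#|S| <= #|Om|)%N ->
  exists c : R, (1 - a) * c <= f (Om :|: S) - f Om /\
    (f Om - f finset.set0) * greedy_factor a g <=
    f S - f finset.set0 +
    (f Om - f finset.set0 - (f S - f finset.set0) + (1 - a) * c) *
      greedy_factor a (g * ((#|Om| - #|S|)%:R / #|Om :\: S|%:R)).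
Proof.
elim=> [_|S' e _ IH _ [eS' e_max]].
  exists 0; rewrite mulr0 addr0 finset.setU0 subrr; split=> //.
  rewrite subrr add0r subr0 cards0 subn0 finset.setD0.
  (* The initial fraction is 1, except for empty [Om], where it is 0 but there is no gain to account
     for. *)
  have [Om0|Om0] := eqVneq #|Om| 0%N.
    by move/cards0_eq: Om0 => ->; rewrite subrr !mul0r.
  by rewrite divff ?pnatr_eq0 // mulr1.
rewrite cardsU1 eS' add1n => ltSO.
have {IH} [c [hc IH]] := IH (ltnW ltSO).
have hr := ratio_step Om S' e (conj eS' e_max).
have rho0 : 0 <= f (e |: S') - f S' by rewrite subr_ge0.
set s := (#|Om| - #|S'|.+1)%N.
have sE : (#|Om| - #|S'|)%N = s.+1 by rewrite /s subnSK.
set r := f Om - f finset.set0 - (f S' - f finset.set0) + (1 - a) * c in IH.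
(* By [hc] the term [(1 - a) * c] is at most the gain of the union over [Om], so the ratio
   inequality passes to [r]. *)
have r_le : r <= f (Om :|: S') - f S' by rewrite /r; lra.
have {}hr : g * r <= #|Om :\: S'|%:R * (f (e |: S') - f S').
  by apply: le_trans hr; exact: ler_wpM2l.
have s_lt : (s < #|Om :\: S'|)%N.
  by rewrite -sE cardsD leq_sub2l // subset_leq_card // finset.subsetIr.
have [eOm|eOm] := boolP (e \in Om).
  exists c; split.
    suff -> : Om :|: (e |: S') = Om :|: S' by [].
    rewrite finset.setUCA finset.setUA.
    by rewrite (finset.setUidPr (_ : [set e]%SET \subset Om)) ?finset.sub1set.
  have mE : #|Om :\: S'| = #|Om :\: (e |: S')|.+1.
    by rewrite (cardsD1 e) inE eS' eOm add1n finset.setDDl finset.setUC.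
  move: hr IH s_lt; rewrite sE mE => hr IH; rewrite ltnS => s_le.
  move: IH (greedy_potential_in _ _ _ _ s_le rho0 hr); rewrite /r.
  by do 3 move: (greedy_factor a _) => ?; lra.
(* Outside [Om], the step lowers [r] by its gain and returns [1 - a] times it through [c]: a net
   loss of [a] times the gain. *)
exists (c + (f (e |: S') - f S')); split.
  by have := curvature_step Om S' e eS' eOm; lra.
have mE : #|Om :\: (e |: S')| = #|Om :\: S'|.
  apply: eq_card => x; rewrite !inE; case: eqVneq => // ->.
  by rewrite !(negPf eOm) !andbF.
rewrite mE; move: IH (greedy_potential_out _ _ _ _ s_lt rho0 hr); rewrite sE /r.
by do 3 move: (greedy_factor a _) => ?; lra.
Qed.

(** When [S] reaches the size of [Om] no step remains, so the last term of the invariant vanishes;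
    later steps only increase [f S]. *)
Lemma greedy_bound_at k (Om S : {set T}) : greedy_state f k S ->
  (#|Om| <= #|S|)%N ->
  (f Om - f finset.set0) * greedy_factor a g <= f S - f finset.set0.
Proof.
elim=> [|S' e stS' IH ltk ch].
  rewrite cards0 leqn0 => /eqP/cards0_eq ->.
  by rewrite !subrr mul0r.
rewrite leq_eqVlt => /orP[/eqP OS|].
  have st : greedy_state f k (e |: S') by exact: greedy_step.
  have [|c [_]] := greedy_invariant _ Om _ st; first by rewrite OS.
  by rewrite OS subnn mul0r mulr0 greedy_factor0 mulr0 addr0.
rewrite cardsU1 (proj1 ch) ltnS => /IH h; apply: le_trans h _.
by rewrite lerD2r.
Qed.

End Greedy.

(** For nondecreasing [f] the value 1 is a curvature bound, and [a] is the least one. *)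
Lemma curvature_le1 {R : realType} {T : finType} (f : {set T} -> R) a :
  (forall (S : {set T}) e, f S <= f (e |: S)) -> is_curvature f a -> a <= 1.
Proof.
move=> f_mono [_ _]; apply=> // Om S j _.
by rewrite subrr mul0r /marginal subr_ge0.
Qed.

(* A ratio above 1 makes the gains of the singletons, hence all gains over the
   empty set, nonpositive. *)
Lemma submod_ratio_le1 {R : realType} {T : finType} (f : {set T} -> R) g Om :
  submod_ratio_bound f g -> f finset.set0 < f Om -> g <= 1.
Proof.
move=> g_ratio Om_gt; rewrite leNgt; apply/negP => g1.
have w_le0 w : marginal f [set w]%SET finset.set0 <= 0.
  have := g_ratio [set w]%SET finset.set0.
  rewrite finset.setD0 big_set1; nra.
have := g_ratio Om finset.set0.
have : \sum_(w in Om :\: finset.set0) marginal f [set w]%SET finset.set0 <= 0.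
  by apply: sumr_le0.
rewrite {2}/marginal finset.setU0; nra.
Qed.

Lemma card_max_attained {R : realType} {T : finType} (f : {set T} -> R) k :
  exists2 Om : {set T}, (#|Om| <= k)%N & card_max f k = f Om.
Proof.
rewrite /card_max; elim/big_rec: _ => [|S x Sk [Om Omk ->]].
  by exists finset.set0; rewrite ?cards0.
by case: (leP (f S) (f Om)) => _; [exists Om | exists S].
Qed.

Lemma greedy_guarantee {R : realType} {T : finType} (f : {set T} -> R) a g k S :
  (forall (S : {set T}) e, f S <= f (e |: S)) ->
  is_submodularity_ratio f g -> is_curvature f a -> greedy_output f k S ->
  greedy_factor a g * (card_max f k - f finset.set0) <= f S - f finset.set0.
Proof.
move=> f_mono [g_ge0 g_ratio _] a_curv [stS]; rewrite -leqNgt => kS.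
have [a_ge0 a_bound _] := a_curv.
have a_le1 := curvature_le1 _ _ f_mono a_curv.
have [Om Omk ->] := card_max_attained f k; rewrite mulrC.
(* The bound [g <= 1] comes from a strictly positive gain; without one the left side is
   nonpositive. *)
have [Om_le|Om_gt] := leP (f Om) (f finset.set0).
  have gf0 : 0 <= greedy_factor a g.
    by rewrite -(greedy_factor0 a) greedy_factor_mono.
  apply: (@le_trans _ _ 0); first by rewrite mulr_le0_ge0 // subr_le0.
  by rewrite subr_ge0 (greedy_state_mono _ f_mono k).
have g_le1 := submod_ratio_le1 _ _ _ g_ratio Om_gt.
exact: (greedy_bound_at _ _ _ f_mono a_ge0 a_le1 a_bound g_ge0 g_le1 g_ratio
  k Om S stS (leq_trans Omk kS)).
Qed.

(** * Antitonicity of the trace of the inverse *)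

(** Take [K] of maximal rank among matrices whose row space satisfies [P]; adjoining a vector of [P]
    cannot raise the rank, so the vector lies in [K] already. *)
Lemma subspace_row_space (F : fieldType) n (P : 'rV[F]_n -> Prop) :
  P 0 -> (forall c u v, P u -> P v -> P (c *: u + v)) ->
  exists K : 'M[F]_n, forall v, P v <-> (v <= K)%MS.
Proof.
move=> P0 PD.
pose inP (K : 'M[F]_n) := forall v, (v <= K)%MS -> P v.
pose rk r := `[< exists2 K, inP K & \rank K = r >].
have exr : exists r, rk r.
  exists 0%N; apply/asboolP; exists 0; last by rewrite mxrank0.
  by move=> v; rewrite submx0 => /eqP ->.
have ubr r : rk r -> (r <= n)%N.
  by move=> /asboolP[K _ <-]; exact: rank_leq_row.
case: (ex_maxnP exr ubr) => r /asboolP[K PK rkK] r_max.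
exists K => v; split; last exact: PK.
move=> Pv; have PKv : inP (K + v)%MS.
  move=> w /sub_addsmxP[[D1 D2] /= ->].
  rewrite addrC [D2]mx11_scalar mul_scalar_mx.
  by apply: PD => //; apply: PK; exact: submxMl.
have := r_max (\rank (K + v)%MS).
rewrite -rkK => /(_ (asboolT (ex_intro2 _ _ _ PKv erefl))) rk_le.
apply: submx_trans (addsmxSr K v) _.
by rewrite -(geq_leqif (mxrank_leqif_sup (addsmxSl K v))).
Qed.

Lemma unitmx_ker0 (F : fieldType) n (K : 'M[F]_n) :
  (forall x : 'cV[F]_n, K *m x = 0 -> x = 0) -> K \in unitmx.
Proof.
move=> K_inj; rewrite -unitmx_tr -row_free_unit -kermx_eq0.
apply/eqP/row_matrixP => i; rewrite row0; apply: trmx_inj; rewrite trmx0.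
apply: K_inj; set u := row i _.
have uK : u *m K^T = 0 by apply/sub_kermxP; exact: row_sub.
by rewrite -[LHS]trmxK trmx_mul trmxK uK trmx0.
Qed.

Lemma pos_unitmx (R : realType) n (W : 'M[R]_n) :
  (forall x : 'cV[R]_n, x != 0 -> 0 < (x^T *m W *m x) ord0 ord0) ->
  W \in unitmx.
Proof.
move=> Wpos; apply: unitmx_ker0 => x Wx; apply/eqP/negPn/negP => /Wpos.
by rewrite -mulmxA Wx mulmx0 mxE ltxx.
Qed.

(* [x^T W^-1 x] is the maximum over [y] of [2 x^T y - y^T W y], which decreases
   in [W]. *)
Lemma quad_invmx_antitone (R : realType) n (W G : 'M[R]_n) (x : 'cV[R]_n) :
  posdefmx W -> (forall x : 'cV[R]_n, 0 <= (x^T *m G *m x) ord0 ord0) ->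
  (x^T *m invmx (W + G) *m x) ord0 ord0 <= (x^T *m invmx W *m x) ord0 ord0.
Proof.
move=> [Wsym Wpos] Gpos.
have uW : W \in unitmx by exact: pos_unitmx.
have uWG : W + G \in unitmx.
  apply: pos_unitmx => y y0; rewrite mulmxDr mulmxDl mxE.
  by rewrite ltr_pwDl ?Wpos.
have tr11 (M : 'M[R]_1) : M ord0 ord0 = M^T ord0 ord0 by rewrite mxE.
set y := invmx (W + G) *m x; set z := invmx W *m x.
have Wz : W *m z = x by rewrite mulKVmx.
have WGy : (W + G) *m y = x by rewrite mulKVmx.
rewrite -!mulmxA -/y -/z.
(* This expands to [z^T x - 2 x^T y + y^T W y]; since [y^T W y = x^T y - y^T G y], it yields
   [x^T y + y^T G y <= z^T x]. *)
have yz0 : 0 <= ((z - y)^T *m W *m (z - y)) ord0 ord0.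
  have [->|yz] := eqVneq (z - y) 0; first by rewrite mulmx0 mxE.
  exact/ltW/Wpos.
have zWy : (z^T *m W *m y) = x^T *m y by rewrite -{1}Wsym -trmx_mul Wz.
have zx : (z^T *m x) ord0 ord0 = (x^T *m z) ord0 ord0.
  by rewrite tr11 trmx_mul trmxK.
have yx : (y^T *m x) ord0 ord0 = (x^T *m y) ord0 ord0.
  by rewrite tr11 trmx_mul trmxK.
have yWGy : (y^T *m W *m y) ord0 ord0 + (y^T *m G *m y) ord0 ord0 =
    (x^T *m y) ord0 ord0.
  by rewrite -yx -[x]WGy mulmxDl mulmxDr !mulmxA [RHS]mxE.
have {}yz0 : 0 <= (z^T *m x) ord0 ord0 - (x^T *m y) ord0 ord0
    - (y^T *m x) ord0 ord0 + (y^T *m W *m y) ord0 ord0.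
  move: yz0; rewrite mulmxBr linearB /= !mulmxBl zWy -![_ *m W *m z]mulmxA Wz.
  by rewrite !mxE; lra.
have := Gpos y; move: yz0; rewrite zx yx; lra.
Qed.

Lemma diag_quad (R : pzRingType) n (M : 'M[R]_n) i : M i i =
  ((delta_mx i 0 : 'cV[R]_n)^T *m M *m (delta_mx i 0 : 'cV[R]_n)) ord0 ord0.
Proof. by rewrite trmx_delta -rowE -colE !mxE. Qed.

Lemma trace_invmx_antitone (R : realType) n (W G : 'M[R]_n) :
  posdefmx W -> (forall x : 'cV[R]_n, 0 <= (x^T *m G *m x) ord0 ord0) ->
  \tr (invmx (W + G)) <= \tr (invmx W).
Proof.
move=> Wpos Gpos; apply: ler_sum => i _.
rewrite (diag_quad _ _ (invmx (W + G))) (diag_quad _ _ (invmx W)).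
exact: quad_invmx_antitone.
Qed.

(** * The matrix exponential *)

(** Cauchy product: the antidiagonals become binomial expansions, and the remaining terms are the
    error to be bounded. *)
Lemma sum_square_triangle (V : nmodType) (F : nat -> nat -> V) N :
  \sum_(i < N) \sum_(j < N) F i j =
  \sum_(k < N) \sum_(i < k.+1) F i (k - i)%N +
  \sum_(i < N) \sum_(j < N | (N <= i + j)%N) F i j.
Proof.
have -> : \sum_(k < N) \sum_(i < k.+1) F i (k - i)%N =
    \sum_(k < N) \sum_(i < N | (i < k.+1)%N) F i (k - i)%N.
  by apply: eq_bigr => k _; rewrite (big_ord_widen N (fun i => F i (k - i)%N)).
rewrite [X in _ = X + _](exchange_big_dep xpredT) //= -big_split /=.
apply: eq_bigr => i _.
rewrite (bigID (fun j : 'I_N => (N <= i + j)%N)) /= addrC; congr (_ + _).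
have -> : \sum_(k < N | (i < k.+1)%N) F i (k - i)%N = \sum_(j < N - i) F i j.
  rewrite -(big_geq_mkord i N xpredT (fun k => F i (k - i)%N)).
  rewrite -{1}[nat_of_ord i]add0n big_addn big_mkord.
  by apply: eq_bigr => j _; rewrite addnK.
rewrite (big_ord_widen N (F i)) ?leq_subr //.
by apply: eq_bigl => j; rewrite -ltnNge ltn_subRL.
Qed.

Section MatrixExponential.
Local Open Scope classical_set_scope.
Context {R : realType} {n : nat}.
Implicit Types (A B X Y : 'M[R]_n) (a b x y : R).

(** A bound on the operator norm for the sup norm, chosen because it is submultiplicative. *)
Definition row_sum_le A a := forall i, \sum_j `|A i j| <= a.

Lemma row_sum_le_exists A : exists2 a, 0 <= a & row_sum_le A a.
Proof.
exists (\sum_i \sum_j `|A i j|) => [|i].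
  by do 2!apply: sumr_ge0 => ? _.
rewrite [leRHS](bigD1 i) //= lerDl.
by do 2!apply: sumr_ge0 => ? _.
Qed.

Lemma row_sum_leM A B a b : 0 <= b ->
  row_sum_le A a -> row_sum_le B b -> row_sum_le (A *m B) (a * b).
Proof.
move=> b0 hA hB i.
apply: (@le_trans _ _ (\sum_l `|A i l| * b)); last first.
  by rewrite -mulr_suml ler_wpM2r.
apply: (@le_trans _ _ (\sum_j \sum_l `|A i l| * `|B l j|)).
  apply: ler_sum => j _; rewrite mxE (le_trans (ler_norm_sum _ _ _)) //.
  by apply: ler_sum => l _; rewrite normrM.
rewrite exchange_big /=; apply: ler_sum => l _.
by rewrite -mulr_sumr ler_wpM2l.
Qed.

Lemma row_sum_le1 : row_sum_le 1 1.
Proof.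
move=> i; rewrite (bigD1 i) //= mxE eqxx normr1 big1 ?addr0 // => j ji.
by rewrite mxE eq_sym (negPf ji) normr0.
Qed.

Lemma row_sum_leX A a k :
  0 <= a -> row_sum_le A a -> row_sum_le (A ^+ k) (a ^+ k).
Proof.
move=> a0 hA; elim: k => [|k IH]; first by rewrite !expr0; exact: row_sum_le1.
by rewrite !exprS; apply: row_sum_leM; rewrite ?exprn_ge0.
Qed.

Lemma row_sum_le_entry A a i j : row_sum_le A a -> `|A i j| <= a.
Proof.
move=> /(_ i); apply: le_trans; rewrite (bigD1 j) //= lerDl.
exact: sumr_ge0.
Qed.

Lemma exp_term_bound A a k i j : 0 <= a -> row_sum_le A a ->
  `|(k`!%:R^-1 *: A ^+ k) i j| <= exp_coeff a k.
Proof.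
move=> a0 hA; rewrite mxE normrM ger0_norm ?invr_ge0 // /exp_coeff /= mulrC.
rewrite ler_wpM2r ?invr_ge0 //.
exact: row_sum_le_entry _ _ _ _ (row_sum_leX _ _ _ a0 hA).
Qed.

Lemma mx_cvg_entries (u : nat -> 'M[R]_n) X :
  (forall i j, u k i j @[k --> \oo] --> X i j) -> u @ \oo --> X.
Proof.
move=> h; apply/cvg_ballP => e e0.
suff : \forall k \near \oo, forall i j, ball (X i j) e (u k i j).
  by apply: filterS => k hk.
apply: filter_forall => i; apply: filter_forall => j.
by have /cvg_ballP := h i j; exact.
Qed.

Lemma expmx_cvg A i j :
  series (fun k => k`!%:R^-1 *: A ^+ k) N i j @[N --> \oo] --> expmx A i j.
Proof.
(* [limn] is meaningful only for a convergent sequence; each entry is dominated by the scalar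
   exponential series at a row-sum bound. *)
suff cvgA : cvgn (series (fun k => k`!%:R^-1 *: A ^+ k)).
  exact: (cvg_comp _ _ cvgA (@coord_continuous _ _ _ i j _)).
have [a a0 hA] := row_sum_le_exists A.
apply/cvg_ex; exists (\matrix_(i, j)
  limn (series (fun k => (k`!%:R^-1 *: A ^+ k) i j))).
apply: mx_cvg_entries => i' j'; rewrite mxE.
have -> : (fun N => series (fun k => k`!%:R^-1 *: A ^+ k) N i' j') =
    series (fun k => (k`!%:R^-1 *: A ^+ k) i' j').
  by apply/funext => N; rewrite /series /= summxE.
apply: normed_cvg; apply: series_le_cvg (is_cvg_series_exp_coeff a) => //.
- by move=> k; exact: normr_ge0.
- by move=> k; exact: exp_coeff_ge0.
- by move=> k /=; exact: exp_term_bound.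
Qed.

Lemma factV_bin k i : (i <= k)%N ->
  k`!%:R^-1 * 'C(k, i)%:R = i`!%:R^-1 * (k - i)`!%:R^-1 :> R.
Proof.
move=> ik; rewrite -(bin_fact ik) !natrM; field.
by rewrite !pnatr_eq0 -!lt0n bin_gt0 ik !fact_gt0.
Qed.

Lemma exp_coeffD x y k :
  exp_coeff (x + y) k = \sum_(i < k.+1) exp_coeff x i * exp_coeff y (k - i)%N.
Proof.
rewrite /exp_coeff /= addrC exprDn mulr_suml; apply: eq_bigr => i _.
have eqV := factV_bin _ _ (ltnSE (ltn_ord i)).
rewrite -[X in X / _]mulr_natr.
transitivity (x ^+ i * y ^+ (k - i) * (k`!%:R^-1 * 'C(k, i)%:R)); first by ring.
by rewrite eqV; ring.
Qed.

Lemma exp_termD X Y k : GRing.comm X Y ->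
  k`!%:R^-1 *: (X + Y) ^+ k = \sum_(i < k.+1)
    (i`!%:R^-1 *: X ^+ i) *m ((k - i)`!%:R^-1 *: Y ^+ (k - i)).
Proof.
move=> cXY; rewrite addrC exprDn_comm; last exact: commr_sym.
rewrite scaler_sumr; apply: eq_bigr => i _.
rewrite -[_ *+ 'C(_, _)]scaler_nat scalerA factV_bin ?(ltnSE (ltn_ord i)) //.
rewrite -scalemxAl -scalemxAr scalerA.
by congr (_ *: _); apply: commrX; apply: commr_sym; exact: commrX.
Qed.

(* The product of the [N]-th partial sums differs from the [N]-th partial sum
   for [X + Y] by the terms with [i + j >= N]; they are dominated by the same
   terms for the row-sum bounds, which vanish in the limit by [expRD]. *)
Lemma expmxD X Y : GRing.comm X Y -> expmx (X + Y) = expmx X *m expmx Y.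
Proof.
move=> cXY; apply/matrixP => p q.
have [x x0 hX] := row_sum_le_exists X; have [y y0 hY] := row_sum_le_exists Y.
pose T (Z : 'M[R]_n) k := k`!%:R^-1 *: Z ^+ k.
pose S Z N : 'M[R]_n := series (T Z) N; pose s (z : R) := series (exp_coeff z).
pose d (N : nat) := s x N * s y N - s (x + y) N.
have d_ge N : `|(S X N *m S Y N) p q - S (X + Y) N p q| <= d N.
  have -> : d N = \sum_(i < N) \sum_(j < N | (N <= i + j)%N)
      exp_coeff x i * exp_coeff y j.
    rewrite /d /s /series /= !big_mkord mulr_suml.
    under [X in X - _]eq_bigr do rewrite mulr_sumr.
    rewrite (sum_square_triangle _ (fun i j => exp_coeff x i * exp_coeff y j)).
    under [X in _ - X]eq_bigr do rewrite exp_coeffD.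
    by rewrite addrC addKr.
  have -> : (S X N *m S Y N) p q - S (X + Y) N p q =
      (\sum_(i < N) \sum_(j < N | (N <= i + j)%N) T X i *m T Y j) p q.
    have <- : S X N *m S Y N - S (X + Y) N =
        \sum_(i < N) \sum_(j < N | (N <= i + j)%N) T X i *m T Y j.
      rewrite /S /series /= !big_mkord mulmx_suml.
      under [X in X - _]eq_bigr do rewrite mulmx_sumr.
      rewrite (sum_square_triangle _ (fun i j => T X i *m T Y j)).
      under [X in _ - X]eq_bigr do rewrite /T exp_termD //.
      by rewrite addrC addKr.
    by rewrite !mxE.
  rewrite summxE (le_trans (ler_norm_sum _ _ _)) //; apply: ler_sum => i _.
  rewrite summxE (le_trans (ler_norm_sum _ _ _)) //; apply: ler_sum => j _.
  rewrite /T -scalemxAl -scalemxAr scalerA mxE normrM.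
  rewrite ger0_norm ?mulr_ge0 ?invr_ge0 //.
  rewrite /exp_coeff /= mulrACA mulrC ler_wpM2r ?mulr_ge0 ?invr_ge0 //.
  apply: row_sum_le_entry; apply: row_sum_leM; rewrite ?exprn_ge0 //;
  exact: row_sum_leX.
have d0 : d N @[N --> \oo] --> 0.
  have -> : 0 = expR x * expR y - expR (x + y) by rewrite expRD subrr.
  by apply: cvgB; [apply: cvgM|]; exact: is_cvg_series_exp_coeff.
have SXY : (S X N *m S Y N) p q @[N --> \oo] --> (expmx X *m expmx Y) p q.
  rewrite mxE; under eq_fun do rewrite mxE.
  by apply: (cvg_big add_continuous) => l _; apply: cvgM; exact: expmx_cvg.
have diff0 : (S X N *m S Y N) p q - S (X + Y) N p q @[N --> \oo] --> 0.
  apply/norm_cvg0P; apply: (squeeze_cvgr _ (cvg_cst 0) d0).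
  by near=> N; rewrite normr_ge0 d_ge.
have lim_diff : (S X N *m S Y N) p q - S (X + Y) N p q @[N --> \oo] -->
    (expmx X *m expmx Y) p q - expmx (X + Y) p q.
  by apply: cvgB => //; exact: expmx_cvg.
have /eqP : (expmx X *m expmx Y) p q - expmx (X + Y) p q = 0.
  exact: (cvg_unique (@norm_hausdorff _ R^o) lim_diff diff0).
by rewrite subr_eq0 => /eqP ->.
Unshelve. all: by end_near.
Qed.

Lemma trmxX A k : (A ^+ k)^T = A^T ^+ k.
Proof.
elim: k => [|k IH]; first by rewrite !expr0 trmx1.
by rewrite exprS exprSr -IH; exact: trmx_mul.
Qed.

Lemma expmx_tr A : expmx A^T = (expmx A)^T.
Proof.
apply/matrixP => i j; rewrite mxE.
apply: (cvg_unique (@norm_hausdorff _ R^o) (expmx_cvg A^T i j)).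
have -> : (fun N => series (fun k => k`!%:R^-1 *: A^T ^+ k) N i j) =
    (fun N => series (fun k => k`!%:R^-1 *: A ^+ k) N j i).
  apply/funext => N; rewrite /series /= !summxE; apply: eq_bigr => k _.
  by rewrite -trmxX !mxE.
exact: expmx_cvg.
Qed.

Lemma exprZmx t A k : (t *: A) ^+ k = t ^+ k *: A ^+ k.
Proof.
elim: k => [|k IH]; first by rewrite !expr0 scale1r.
rewrite !exprS IH; rewrite -[(t *: A) * _]/((t *: A) *m _).
by rewrite -scalemxAl -scalemxAr scalerA.
Qed.

(** The entry is a pointwise limit of polynomials in [t]. *)
Lemma measurable_expmx A i j :
  measurable_fun setT (fun t : R => expmx (t *: A) i j).
Proof.
pose h N (t : R) := series (fun k => k`!%:R^-1 *: (t *: A) ^+ k) N i j.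
apply: (measurable_fun_cvg (h := h)) => [N|t _]; last exact: expmx_cvg.
rewrite /h /series /=; under eq_fun do rewrite summxE.
apply: measurable_sum => k; under eq_fun do rewrite exprZmx !mxE.
apply: measurable_funM => //; apply: measurable_funM => //.
Qed.

End MatrixExponential.

(** * Gramians *)

Section HalfLineL2.
Local Open Scope classical_set_scope.
Context {R : realType}.
Local Notation mu := (@lebesgue_measure R).
Local Notation D := (`[0, +oo[%classic : set R).
Implicit Types (f g : R -> R).

(** Measurability is asked on the whole line so that translates are measurable by composition. *)
Definition sq_integrable f :=
  measurable_fun setT f /\ mu.-integrable D (EFin \o (fun t => f t ^+ 2)).

Lemma integrable_le f g : measurable_fun setT f ->
  (forall t, `|f t| <= g t) ->
  mu.-integrable D (EFin \o g) -> mu.-integrable D (EFin \o f).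
Proof.
move=> mf fg; apply: le_integrable => //.
  by apply/measurable_EFinP; exact: measurable_funTS.
by move=> t _ /=; rewrite lee_fin (le_trans (fg t)) // ler_norm.
Qed.

Lemma integrableD_fin f g : mu.-integrable D (EFin \o f) ->
  mu.-integrable D (EFin \o g) ->
  mu.-integrable D (EFin \o (fun t => f t + g t)).
Proof. by move=> hf hg; exact: (integrableD _ hf hg). Qed.

Lemma integrableZ_fin c f : mu.-integrable D (EFin \o f) ->
  mu.-integrable D (EFin \o (fun t => c * f t)).
Proof. by move=> hf; exact: (integrableZl _ c hf). Qed.

Lemma sq_integrable_lin c f g : sq_integrable f -> sq_integrable g ->
  sq_integrable (fun t => c * f t + g t).
Proof.
move=> [mf hf] [mg hg].
have mfg : measurable_fun setT (fun t => c * f t + g t).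
  by apply: measurable_funD => //; exact: measurable_funM.
split=> //.
apply: (integrable_le _ (fun t => (2 * c ^+ 2) * f t ^+ 2 + 2 * g t ^+ 2)).
- exact: measurable_funX.
- move=> t; rewrite ger0_norm ?sqr_ge0 //.
  have := sqr_ge0 (c * f t - g t); nra.
- by apply: integrableD_fin; exact: integrableZ_fin.
Qed.

Lemma sq_integrable0 : sq_integrable (fun=> 0).
Proof.
split; first exact: measurable_cst.
have -> : EFin \o (fun t : R => 0 ^+ 2) = cst 0%E :> (R -> \bar R).
  by apply/funext => t /=; rewrite expr0n.
exact: integrable0.
Qed.

Lemma sq_integrable_mul f g : sq_integrable f -> sq_integrable g ->
  mu.-integrable D (EFin \o (fun t => f t * g t)).
Proof.
move=> [mf hf] [mg hg].
apply: (integrable_le _ (fun t => f t ^+ 2 + g t ^+ 2)).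
- exact: measurable_funM.
- move=> t; have := sqr_ge0 (f t); have := sqr_ge0 (g t).
  have := sqr_ge0 (f t + g t); have := sqr_ge0 (f t - g t).
  by rewrite ler_norml => ? ? ? ?; apply/andP; split; nra.
- exact: integrableD_fin.
Qed.

Lemma Rintegral_sum (I : Type) (r : seq I) (P : pred I) (h : I -> R -> R) :
  (forall i, mu.-integrable D (EFin \o h i)) ->
  mu.-integrable D (EFin \o (fun t => \sum_(i <- r | P i) h i t)) /\
  \int[mu]_(t in D) (\sum_(i <- r | P i) h i t) =
  \sum_(i <- r | P i) \int[mu]_(t in D) h i t.
Proof.
move=> hh; elim: r => [|i r [IH1 IH2]].
  have -> : (fun t => \sum_(i <- [::] | P i) h i t) = cst 0.
    by apply/funext => t; rewrite big_nil.
  by rewrite big_nil Rintegral_cst // mul0r; split => //; exact: integrable0.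
case Pi: (P i); last first.
  have -> : (fun t => \sum_(j <- i :: r | P j) h j t) =
      (fun t => \sum_(j <- r | P j) h j t).
    by apply/funext => t; rewrite big_cons Pi.
  by rewrite big_cons Pi.
have -> : (fun t => \sum_(j <- i :: r | P j) h j t) =
    (fun t => h i t + \sum_(j <- r | P j) h j t).
  by apply/funext => t; rewrite big_cons Pi.
by rewrite big_cons Pi -IH2 RintegralD //; split => //; exact: integrableD_fin.
Qed.

(** Lebesgue measure is determined by its values on half-open intervals, whose lengths a translation
    preserves. *)
Lemma lebesgue_measure_shift (s : R) (A : set R) : measurable A ->
  pushforward mu (fun t : R => t + s : measurableTypeR R) A = mu A.
Proof.
move=> mA; apply/esym/lebesgue_measure_unique => //=.
  exact: measurable_funD.
move=> ? _ [[a b]] _ <-.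
rewrite /pushforward /=.
have -> : (fun t : R => t + s) @^-1` `]a, b]%classic = `]a - s, b - s]%classic.
  by apply/seteqP; split => t /=; rewrite !in_itv /= ltrBlDr lerBrDr.
rewrite !lebesgue_measure_itv /= !lte_fin ltrD2r -!EFinD.
by have -> : b - s - (a - s) = b - a by ring.
Qed.

(** A change of variables moves the integral to [[s, +oo[], a part of the half-line. *)
Lemma sq_integrable_shift s f : 0 <= s -> sq_integrable f ->
  sq_integrable (fun t => f (t + s)).
Proof.
move=> s0 [mf hf].
have ms : measurable_fun setT (fun t : R => t + s : measurableTypeR R).
  exact: measurable_funD.
have mfs : measurable_fun setT (fun t : R => f (t + s)).
  exact: (measurableT_comp mf ms).
split=> //; apply/integrableP; split.
  by apply/measurable_EFinP/measurable_funTS/measurable_funX.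
have mf2 : measurable_fun setT (fun t : R => `|(f t ^+ 2)%:E|%E).
  by apply: measurableT_comp => //; apply/measurable_EFinP/measurable_funX.
have : (\int[mu]_(t in `[s, +oo[%classic) `|(f t ^+ 2)%:E| < +oo)%E.
  have /integrableP[_] := hf; apply: le_lt_trans.
  apply: ge0_subset_integral => //=.
  - exact: measurable_funTS.
  - by move=> t /=; rewrite !in_itv /= !andbT; exact: le_trans.
have -> : (\int[mu]_(t in `[s, +oo[%classic) `|(f t ^+ 2)%:E| =
    \int[pushforward mu (fun t : R => (t + s)%R : measurableTypeR R)]_
      (t in `[s, +oo[%classic) `|(f t ^+ 2)%:E|)%E.
  apply: eq_measure_integral => //= A mA _; exact/esym/lebesgue_measure_shift.
rewrite ge0_integral_pushforward //=; last exact: measurable_funTS.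
suff -> : (fun t : R => t + s) @^-1` `[s, +oo[%classic = D by [].
by apply/seteqP; split => t /=; rewrite !in_itv /= !andbT lerDr.
Qed.

End HalfLineL2.

(** * Gramians of single input vectors *)

Section Gramian.
Local Open Scope classical_set_scope.
Context {R : realType} {n : nat}.
Local Notation mu := (@lebesgue_measure R).
Local Notation D := (`[0, +oo[%classic : set R).
Variable A : 'M[R]_n.
Implicit Types (Q : 'M[R]_n) (u v : 'cV[R]_n) (x : 'cV[R]_n).

(** Coordinate [i] of the solution of [x' = A x] started at [v]. *)
Definition flow v (i : 'I_n) (t : R) : R := (expmx (t *: A) *m v) i 0.

Definition sq_integrable_flow v := forall i, sq_integrable (flow v i).

Lemma flow_sum v i t : flow v i t = \sum_j expmx (t *: A) i j * v j 0.
Proof. by rewrite /flow mxE. Qed.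

Lemma measurable_flow v i : measurable_fun setT (flow v i).
Proof.
rewrite (funext (flow_sum v i)).
apply: measurable_sum => j; apply: measurable_funM => //.
exact: measurable_expmx.
Qed.

Lemma flow_lin c u v i t : flow (c *: u + v) i t = c * flow u i t + flow v i t.
Proof. by rewrite /flow mulmxDr -scalemxAr !mxE. Qed.

Lemma flow_shift v i s t : flow (expmx (s *: A) *m v) i t = flow v i (t + s).
Proof.
rewrite /flow scalerDl expmxD ?mulmxA //.
rewrite /GRing.comm -[LHS]/((t *: A) *m (s *: A)) -[RHS]/((s *: A) *m (t *: A)).
by rewrite -!scalemxAl -!scalemxAr !scalerA mulrC.
Qed.

Lemma gramian_integrand (I : Type) (r : seq I) (P : pred I) (v : I -> 'cV[R]_n)
    i j t :
  (expmx (t *: A) *m (\sum_(l <- r | P l) v l *m (v l)^T) *m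
     expmx (t *: A^T)) i j =
  \sum_(l <- r | P l) flow (v l) i t * flow (v l) j t.
Proof.
rewrite mulmx_sumr mulmx_suml summxE; apply: eq_bigr => l _.
have -> : t *: A^T = (t *: A)^T by apply/matrixP => a b; rewrite !mxE.
rewrite expmx_tr mulmxA -mulmxA -trmx_mul.
by rewrite mxE big_ord1 [X in _ * X]mxE.
Qed.

Lemma gramian_rank1E v i j : gramian A (v *m v^T) i j =
  \int[mu]_(t in D) (flow v i t * flow v j t).
Proof.
rewrite mxE; apply: eq_Rintegral => t _.
have := gramian_integrand _ [:: tt] xpredT (fun=> v) i j t.
by rewrite !big_seq1.
Qed.

(** Additivity of the integral requires integrable entries, which are products of two square
    integrable flows. *)
Lemma gramian_sum (I : Type) (r : seq I) (P : pred I) (v : I -> 'cV[R]_n) :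
  (forall l, sq_integrable_flow (v l)) ->
  gramian A (\sum_(l <- r | P l) v l *m (v l)^T) =
  \sum_(l <- r | P l) gramian A (v l *m (v l)^T).
Proof.
move=> hv; apply/matrixP => i j; rewrite summxE.
under [RHS]eq_bigr do rewrite gramian_rank1E.
rewrite mxE; under eq_Rintegral do rewrite gramian_integrand.
have [|_ ->//] := Rintegral_sum _ r P
  (fun l t => flow (v l) i t * flow (v l) j t).
by move=> l; apply: sq_integrable_mul; exact: hv.
Qed.

Lemma gramian_rank1_sym v : (gramian A (v *m v^T))^T = gramian A (v *m v^T).
Proof.
apply/matrixP => i j; rewrite mxE !gramian_rank1E.
by apply: eq_Rintegral => t _; rewrite mulrC.
Qed.

(** The integral of a square shows semidefiniteness, and vanishing when [x] is orthogonal to the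
    trajectory. *)
Lemma gramian_rank1_quad v x : sq_integrable_flow v ->
  (x^T *m gramian A (v *m v^T) *m x) ord0 ord0 =
  \int[mu]_(t in D) (\sum_i x i 0 * flow v i t) ^+ 2.
Proof.
move=> hv.
have hint i j : mu.-integrable D
    (EFin \o (fun t => x j 0 * x i 0 * (flow v i t * flow v j t))).
  by apply: integrableZ_fin; exact: sq_integrable_mul.
pose h j t := \sum_i x j 0 * x i 0 * (flow v i t * flow v j t).
have hj j : mu.-integrable D (EFin \o h j) /\
    \int[mu]_(t in D) h j t = x j 0 * \sum_i x i 0 * gramian A (v *m v^T) i j.
  have [|h1 h2] := Rintegral_sum _ (index_enum 'I_n) xpredT
    (fun i t => x j 0 * x i 0 * (flow v i t * flow v j t)); first by [].
  split=> //; rewrite h2 mulr_sumr; apply: eq_bigr => i _.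
  rewrite RintegralZl //; last exact: sq_integrable_mul.
  by rewrite gramian_rank1E mulrA.
transitivity (\int[mu]_(t in D) \sum_j h j t).
  have [|_ ->] := Rintegral_sum _ (index_enum 'I_n) xpredT h.
    by move=> j; have [] := hj j.
  rewrite mxE; apply: eq_bigr => j _; have [_ ->] := hj j.
  rewrite mulrC mxE; congr (_ * _).
  by apply: eq_bigr => i _; rewrite mxE.
apply: eq_Rintegral => t _; rewrite expr2 mulr_suml; apply: eq_bigr => j _.
rewrite mulr_sumr; apply: eq_bigr => i _; ring.
Qed.

End Gramian.

Lemma mulmx_tr_sum_col (R : comPzRingType) n m (B : 'M[R]_(n, m)) :
  B *m B^T = \sum_c col c B *m (col c B)^T.
Proof.
apply/matrixP => i j; rewrite summxE mxE; apply: eq_bigr => c _.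
by rewrite !mxE big_ord1 !mxE.
Qed.

(** * Convergence of all Gramians and monotonicity of [f] *)

Section ControllableFlow.
Local Open Scope classical_set_scope.
Context {R : realType} {n m : nat}.
Local Notation mu := (@lebesgue_measure R).
Local Notation D := (`[0, +oo[%classic : set R).
Variables (A : 'M[R]_n) (B0 : 'M[R]_(n, m)).
Hypothesis W0pos : posdefmx (gramian A (B0 *m B0^T)).

(* An infinite diagonal integral would make the Gramian entry [fine +oo = 0]. *)
Lemma input_flow_sq_integrable c : sq_integrable_flow A (col c B0).
Proof.
move=> i; split; first exact: measurable_flow.
pose G t := \sum_c (flow A (col c B0) i t) ^+ 2.
have G0 t : 0 <= G t by apply: sumr_ge0 => c' _; exact: sqr_ge0.
have mG : measurable_fun setT G.
  apply: measurable_sum => c'; apply: measurable_funX.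
  exact: measurable_flow.
have W0ii : 0 < \int[mu]_(t in D) G t.
  have -> : \int[mu]_(t in D) G t = gramian A (B0 *m B0^T) i i.
    rewrite mxE; apply: eq_Rintegral => t _.
    by rewrite mulmx_tr_sum_col gramian_integrand.
  rewrite diag_quad; apply: (proj2 W0pos).
  apply/eqP => /matrixP/(_ i 0); rewrite !mxE !eqxx => /eqP.
  by rewrite oner_eq0.
have iG : mu.-integrable D (EFin \o G).
  apply/integrableP; split.
    by apply/measurable_EFinP; exact: measurable_funTS.
  rewrite ltey; apply/eqP => Gy; move: W0ii; rewrite /Rintegral.
  suff -> : (\int[mu]_(t in D) (G t)%:E = +oo)%E by rewrite ltxx.
  by rewrite -Gy; apply: eq_integral => t _ /=; rewrite ger0_norm.
apply: integrable_le iG.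
  by apply: measurable_funX; exact: measurable_flow.
move=> t; rewrite ger0_norm ?sqr_ge0 // /G (bigD1 c) //= lerDl.
by apply: sumr_ge0 => c' _; exact: sqr_ge0.
Qed.

(* The vectors [v] with square integrable flow form a subspace, stable under
   the flow, that contains the columns of [B0].  A vector [x] orthogonal to all
   flowed columns satisfies [x^T W x = 0], so this subspace is everything. *)
Lemma flow_sq_integrable v : sq_integrable_flow A v.
Proof.
(* The transpose turns column vectors into elements of a row space. *)
have [||K hK] := @subspace_row_space _ n (fun u => sq_integrable_flow A u^T).
- move=> i; have -> : flow A 0^T i = fun=> 0.
    by apply/funext => t; rewrite /flow trmx0 mulmx0 mxE.
  exact: sq_integrable0.
- move=> c u w hu hw i.
  have -> : flow A (c *: u + w)^T i =
      fun t => c * flow A u^T i t + flow A w^T i t.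
    by apply/funext => t; rewrite linearD linearZ /= flow_lin.
  exact: sq_integrable_lin.
suff uK : K \in unitmx.
  by rewrite -[v]trmxK; apply/hK; rewrite submx_full // row_full_unit.
apply: unitmx_ker0 => x Kx; apply/eqP/negPn/negP => /(proj2 W0pos).
have flow0 c s : 0 <= s -> \sum_i x i 0 * flow A (col c B0) i s = 0.
  move=> s0.
  (* The flow of a flowed column is a translate of the original flow, so the flowed column lies in
     [K], and [K *m x = 0] makes it orthogonal to [x]. *)
  have : ((expmx (s *: A) *m col c B0)^T <= K)%MS.
    apply/hK; rewrite trmxK => i; rewrite (funext (flow_shift _ _ _ _)).
    by apply: sq_integrable_shift => //; exact: input_flow_sq_integrable.
  move=> /submxP[L hL].
  have : ((expmx (s *: A) *m col c B0)^T *m x) ord0 ord0 = 0.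
    by rewrite hL -mulmxA Kx mulmx0 mxE.
  rewrite mxE => {2}<-; apply: eq_bigr => i _.
  by rewrite [X in _ = X * _]mxE mulrC.
rewrite mulmx_tr_sum_col gramian_sum; last exact: input_flow_sq_integrable.
rewrite mulmx_sumr mulmx_suml summxE big1 ?ltxx // => c _.
rewrite gramian_rank1_quad; last exact: input_flow_sq_integrable.
(* Zero is written as the integral of a constant, so that integrands are compared only for [0 <= t],
   where [flow0] applies. *)
rewrite -[RHS](mul0r (fine (mu D))) -Rintegral_cst //.
apply: eq_Rintegral => t; rewrite inE /= in_itv /= andbT => t0.
by rewrite flow0 // expr0n.
Qed.

Variables (M : nat) (b : 'I_M -> 'cV[R]_n).
Local Notation f := (neg_tr_inv_gramian A B0 b).

Lemma rank1_quad_ge0 (v x : 'cV[R]_n) :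
  0 <= (x^T *m gramian A (v *m v^T) *m x) ord0 ord0.
Proof.
rewrite gramian_rank1_quad; last exact: flow_sq_integrable.
by apply: Rintegral_ge0 => t _; exact: sqr_ge0.
Qed.

Lemma gramian_withE (S : {set 'I_M}) : gramian_with A B0 b S =
  gramian A (B0 *m B0^T) + \sum_(j in S) gramian A (b j *m (b j)^T).
Proof.
by rewrite /gramian_with gramian_sum // => j; exact: flow_sq_integrable.
Qed.

Lemma gramian_with_posdef (S : {set 'I_M}) : posdefmx (gramian_with A B0 b S).
Proof.
rewrite gramian_withE; split.
  rewrite linearD linear_sum /= (proj1 W0pos); congr (_ + _).
  by apply: eq_bigr => j _; exact: gramian_rank1_sym.
move=> x x0; rewrite mulmxDr mulmxDl mxE.
rewrite ltr_pwDl //; first exact: (proj2 W0pos).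
rewrite mulmx_sumr mulmx_suml summxE; apply: sumr_ge0 => j _.
exact: rank1_quad_ge0.
Qed.

(** A new actuator adds a positive semidefinite matrix to a positive definite Gramian, which lowers
    the trace of the inverse. *)
Lemma neg_tr_inv_gramian_mono (S : {set 'I_M}) e : f S <= f (e |: S)%SET.
Proof.
have [eS|eS] := boolP (e \in S).
  by rewrite (finset.setUidPr (_ : [set e]%SET \subset S)) // finset.sub1set.
rewrite /neg_tr_inv_gramian lerN2.
have -> : gramian_with A B0 b (e |: S)%SET =
    gramian_with A B0 b S + gramian A (b e *m (b e)^T).
  rewrite !gramian_withE big_setU1 //= -addrA; congr (_ + _).
  exact: addrC.
apply: trace_invmx_antitone; first exact: gramian_with_posdef.
exact: rank1_quad_ge0.
Qed.

End ControllableFlow.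

Theorem corollary1 (R : realType) (n m M : nat)
  (A : 'M[R]_n) (hA : stable A)
  (b : 'I_M -> 'cV[R]_n) (hb : injective b) (hb0 : exists j, b j != 0)
  (B0 : 'M[R]_(n, m)) (hB0 : posdefmx (gramian A (B0 *m B0^T)))
  (gamma alpha : R)
  (hgamma : is_submodularity_ratio (neg_tr_inv_gramian A B0 b) gamma)
  (halpha : is_curvature (neg_tr_inv_gramian A B0 b) alpha)
  (k : nat) (hk1 : (1 <= k)%N) (hkM : (k <= M)%N)
  (Sgreedy : {set 'I_M})
  (hS : greedy_output (neg_tr_inv_gramian A B0 b) k Sgreedy) :
  let f := neg_tr_inv_gramian A B0 b in
  f Sgreedy - f finset.set0
    >= greedy_factor alpha gamma * (card_max f k - f finset.set0).
Proof.
by apply: (greedy_guarantee _ _ _ _ _ _ hgamma halpha hS) => S e;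
  exact: neg_tr_inv_gramian_mono.
Qed.
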